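(* Let $k\in\mathbb{Z}$, $\mu\in\mathbb{C}$, $s\in\mathbb{Z}_{\ge0}$, and $\lambda\in\mathbb{C}$ with $\lambda\neq1$. For every integer $n\ge0$, as polynomials in $x$, $$CP_{n}^{(k)}(x;\lambda,\mu)=\sum_{m=0}^{n}(-1)^{m}\left\{\sum_{l=0}^{n-m}\sum_{i=0}^{\min\{s,l\}}\binom{n}{l}\binom{s}{i}(l)_{i}\left(\frac{\lambda}{\lambda-1}\right)^{i}S_{1}(n-l,m)\,CP_{l-i}^{(k)}(s;\lambda,\mu)\right\}H_{m}^{(s)}(x|\lambda).$$
   Context: All generating functions are formal power series in $t$ over $\mathbb{C}$. For $k\in\mathbb{Z}$, $\mathrm{Lif}_k(t)=\sum_{n=0}^{\infty}\frac{t^{n}}{n!(n+1)^{k}}$. For $\lambda,\mu\in\mathbb{C}$, $(1+t)^{\lambda}=\sum_{j\ge0}\binom{\lambda}{j}t^j$ and $(1+(1+t)^{\lambda})^{-\mu}=2^{-\mu}\bigl(1+\frac12\sum_{j\ge 1}\binom{\lambda}{j}t^{j}\bigr)^{-\mu}$ (binomial series, $2^{-\mu}=e^{-\mu\log 2}$). The poly-Cauchy of the first kind and Peters mixed-type polynomials $CP_n^{(k)}(x;\lambda,\mu)$ are defined by $$(1+(1+t)^{\lambda})^{-\mu}\,\mathrm{Lif}_k(\log(1+t))\,(1+t)^{-x}=\sum_{n=0}^{\infty}CP_n^{(k)}(x;\lambda,\mu)\frac{t^n}{n!}.$$ The falling factorial is $(x)_n=x(x-1)\cdots(x-n+1)$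 (with $(x)_0=1$), and the Stirling numbers of the first kind $S_1(n,l)$ are defined by $(x)_n=\sum_{l=0}^{n}S_1(n,l)x^{l}$, with $S_1(n,l)=0$ for $l>n$. For $\lambda\ne1$ and $s\in\mathbb{Z}_{\ge0}$, the Frobenius-Euler polynomials of order $s$ are defined by $\left(\frac{1-\lambda}{e^{t}-\lambda}\right)^{s}e^{xt}=\sum_{n\ge0}H_n^{(s)}(x|\lambda)\frac{t^n}{n!}$. The same $\lambda$ is used in $CP_n^{(k)}(x;\lambda,\mu)$ and in $H_m^{(s)}(x|\lambda)$. A zeroth power equals $1$. *)

(* Defs.v *)
(* The field of complex numbers is R[i], for R : realType. *)
From HB Require Import structures.
From mathcomp Require Import all_boot all_order all_algebra.
From mathcomp Require Import complex.
From mathcomp Require Import boolp reals sequences exp trigo.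

Set Implicit Arguments.
Unset Strict Implicit.
Unset Printing Implicit Defensive.
Set Warnings "-redundant-canonical-projection".

Import Order.TTheory GRing.Theory Num.Theory.
Local Open Scope ring_scope.
Local Open Scope complex_scope.

Record fps (A : Type) := Fps { fps_coef :> nat -> A }.

Lemma fpsP (A : Type) (f g : fps A) : (forall n, f n = g n) -> f = g.
Proof. by case: f g => [f] [g] /= /funext ->. Qed.

HB.instance Definition _ (A : Type) := gen_eqMixin (fps A).
HB.instance Definition _ (A : Type) := gen_choiceMixin (fps A).

Section FpsRing.
Variable A : comNzRingType.
Implicit Types f g h : fps A.

Definition fpsC (c : A) : fps A := Fps (fun n => if n == 0%N then c else 0).
Definition fps_add f g : fps A := Fps (fun n => f n + g n).
Definition fps_opp f : fps A := Fps (fun n => - f n).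
Definition fps_mul f g : fps A :=
  Fps (fun n => \sum_(i < n.+1) f i * g (n - i)%N).

Fact fps_addA : associative fps_add.
Proof. by move=> f g h; apply: fpsP => n /=; rewrite addrA. Qed.
Fact fps_addC : commutative fps_add.
Proof. by move=> f g; apply: fpsP => n /=; rewrite addrC. Qed.
Fact fps_add0 : left_id (fpsC 0) fps_add.
Proof. by move=> f; apply: fpsP => n /=; rewrite if_same add0r. Qed.
Fact fps_addN : left_inverse (fpsC 0) fps_opp fps_add.
Proof. by move=> f; apply: fpsP => n /=; rewrite if_same addNr. Qed.

HB.instance Definition _ :=
  GRing.isZmodule.Build (fps A) fps_addA fps_addC fps_add0 fps_addN.

Definition fps_trunc N f : {poly A} := \poly_(i < N.+1) f i.

Lemma coef_fps_trunc N f i : (i <= N)%N -> (fps_trunc N f)`_i = f i.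
Proof. by move=> leiN; rewrite coef_poly ltnS leiN. Qed.

Lemma fps_mul_trunc N f g n :
  (n <= N)%N -> fps_mul f g n = (fps_trunc N f * fps_trunc N g)`_n.
Proof.
move=> lenN; rewrite coefM /=; apply: eq_bigr => i _.
have lein : (i <= n)%N by rewrite -ltnS.
by rewrite !coef_fps_trunc // ?(leq_trans lein) // (leq_trans (leq_subr _ _)).
Qed.

Fact fps_mulC : commutative fps_mul.
Proof.
by move=> f g; apply: fpsP => n; rewrite !(@fps_mul_trunc n) // mulrC.
Qed.

Fact fps_mulA : associative fps_mul.
Proof.
move=> f g h; apply: fpsP => n.
transitivity ((fps_trunc n f * (fps_trunc n g * fps_trunc n h))`_n).
  rewrite coefM /=; apply: eq_bigr => i _.
  by rewrite coef_fps_trunc -1?ltnS // -fps_mul_trunc // leq_subr.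
rewrite mulrA coefM /=; apply: eq_bigr => i _.
rewrite coef_fps_trunc ?leq_subr // -fps_mul_trunc //.
by rewrite -ltnS.
Qed.

Fact fps_mul1 : left_id (fpsC 1) fps_mul.
Proof.
move=> f; apply: fpsP => n /=.
rewrite big_ord_recl /= subn0 mul1r big1 ?addr0 // => i _.
by rewrite mul0r.
Qed.

Fact fps_mulDl : left_distributive fps_mul fps_add.
Proof.
move=> f g h; apply: fpsP => n /=; rewrite -big_split /=.
by apply: eq_bigr => i _; rewrite mulrDl.
Qed.

Fact fps_1neq0 : fpsC 1 != 0.
Proof.
apply/eqP => /(congr1 (fun f : fps A => f 0%N)) /= /eqP.
by rewrite oner_eq0.
Qed.

HB.instance Definition _ := GRing.Zmodule_isComNzRing.Build (fps A)
  fps_mulA fps_mulC fps_mul1 fps_mulDl fps_1neq0.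

End FpsRing.

Section FpsUnitRing.
Variable A : comUnitRingType.
Implicit Types f g : fps A.

Definition fps_unit : pred (fps A) := fun f => f 0%N \is a GRing.unit.

(* The coefficients b_0, ..., b_n of 1/f, by
   b_0 = 1/f_0,  b_(n+1) = - (1/f_0) * \sum_(i <= n) f_(i+1) b_(n-i). *)
Fixpoint fps_inv_seq f (n : nat) : seq A :=
  if n is n'.+1 then
    let b := fps_inv_seq f n' in
    rcons b (- (f 0%N)^-1 * \sum_(i < n) f i.+1 * b`_(n' - i))
  else [:: (f 0%N)^-1].

(* Following the convention of the library, non-units are left unchanged. *)
Definition fps_inv f : fps A :=
  if fps_unit f then Fps (fun n => (fps_inv_seq f n)`_n) else f.

Lemma size_fps_inv_seq f n : size (fps_inv_seq f n) = n.+1.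
Proof. by elim: n => //= n IHn; rewrite size_rcons IHn. Qed.

Lemma nth_fps_inv_seq f n m :
  (m <= n)%N -> (fps_inv_seq f n)`_m = (fps_inv_seq f m)`_m.
Proof.
elim: n => [|n IHn]; first by rewrite leqn0 => /eqP ->.
rewrite leq_eqVlt => /orP[/eqP -> //|ltmn].
by rewrite /= nth_rcons size_fps_inv_seq ltmn IHn.
Qed.

Fact fps_mulVr : {in fps_unit, left_inverse 1 fps_inv *%R}.
Proof.
move=> f; rewrite unfold_in => uf; rewrite mulrC.
rewrite /fps_inv /fps_unit uf; apply: fpsP => -[|n] /=.
  by rewrite big_ord1 /= divrr.
rewrite big_ord_recl /= subn0 nth_rcons size_fps_inv_seq ltnn eqxx.
rewrite mulrA mulrN divrr // mulN1r addrC; apply/eqP; rewrite subr_eq0.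
apply/eqP/eq_bigr => i _; rewrite /bump leq0n add1n subSS.
by rewrite (@nth_fps_inv_seq f n) // leq_subr.
Qed.

Fact fps_unitPl f g : g * f = 1 -> fps_unit f.
Proof.
move=> /(congr1 (fun h : fps A => h 0%N)) /=.
rewrite big_ord1 /= => gf1; apply/unitrP; exists (g 0%N).
by rewrite [f 0%N * _]mulrC.
Qed.

Fact fps_inv_out : {in [predC fps_unit], fps_inv =1 id}.
Proof. by move=> f; rewrite inE unfold_in /fps_inv /fps_unit => /negPf ->. Qed.

HB.instance Definition _ := GRing.ComNzRing_hasMulInverse.Build (fps A)
  fps_mulVr fps_unitPl fps_inv_out.

End FpsUnitRing.

Definition map_fps (A B : Type) (h : A -> B) (f : fps A) : fps B :=
  Fps (fun n => h (f n)).

(* The composite f(g(t)), meaningful when g has zero constant term: then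
   [t^n] g^i = 0 for i > n and the sum below is all of \sum_i f_i [t^n] g^i. *)
Definition fps_comp (A : comNzRingType) (f g : fps A) : fps A :=
  Fps (fun n => \sum_(i < n.+1) f i * (g ^+ i) n).

(* The f_n of f(t) = \sum_n f_n t^n / n!. *)
Definition egf_coef (A : comNzRingType) (f : fps A) (n : nat) : A :=
  n`!%:R * f n.

Section Series.
(* Used at A = C and at A = {poly C}, where the integers j`! and j > 0
   are units. *)
Variable A : comUnitRingType.

Definition gbinom (a : A) (j : nat) : A :=
  (\prod_(i < j) (a - i%:R)) / j`!%:R.

(* (1 + t)^a *)
Definition fps_pow1D (a : A) : fps A := Fps (gbinom a).

(* e^(a t) *)
Definition fps_exp (a : A) : fps A := Fps (fun j => a ^+ j / j`!%:R).

(* log (1 + t) *)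
Definition fps_log1D : fps A :=
  Fps (fun j => if j == 0%N then 0 else (-1) ^+ j.-1 / j%:R).

End Series.

Definition falling_poly (n : nat) : {poly int} :=
  \prod_(i < n) ('X - (i%:Z)%:P).

(* This is 0 for l > n since falling_poly n has degree n. *)
Definition stirling1 (n l : nat) : int := (falling_poly n)`_l.

Section Polynomials.
Variable R : realType.
Local Notation C := R[i].

Definition expC (z : C) : C :=
  (expR (complex.Re z))%:C * (cos (complex.Im z) +i* sin (complex.Im z)).

Definition Lif (k : int) : fps C :=
  Fps (fun n => (n`!%:R * n.+1%:R ^ k)^-1).

(* (1 + (1 + t)^lambda)^(- mu), with 2^(- mu) = e^(- mu log 2) *)
Definition peters_factor (lambda mu : C) : fps C :=
  fpsC (expC (- mu * (ln (2 : R))%:C)) *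
  fps_comp (fps_pow1D (- mu))
    (Fps (fun j => if j == 0%N then 0 else 2^-1 * gbinom lambda j)).

(* CP_n^(k)(x; lambda, mu), as a polynomial in x *)
Definition CP (k : int) (lambda mu : C) (n : nat) : {poly C} :=
  egf_coef
    (map_fps polyC
       (peters_factor lambda mu * fps_comp (Lif k) (fps_log1D C))
     * fps_pow1D (- 'X)) n.

(* H_n^(s)(x | lambda), as a polynomial in x; the constant term 1 - lambda
   of the denominator is a unit exactly when lambda != 1. *)
Definition frobenius_euler (s : nat) (lambda : C) (n : nat) : {poly C} :=
  egf_coef
    (map_fps polyC
       ((fpsC (1 - lambda) / (fps_exp 1 - fpsC lambda)) ^+ s)
     * fps_exp 'X) n.

End Polynomials.

(* Main.v *)
(* Let H(t) be the generating function of the Frobenius-Euler polynomials.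
   Substituting - log (1 + t) for t turns e^(x t) into (1 + t)^(- x) and
   (e^t - lambda) / (1 - lambda) into (1 + t)^(-1) (1 + c t), where
   c = lambda / (lambda - 1). Hence
     (1 + t)^(- x) = (1 + t)^(- s) (1 + c t)^s H(- log (1 + t)).
   Multiply by the factor of the generating function of CP free of x: its
   product with (1 + t)^(- s) generates the CP_j(s), (1 + c t)^s expands
   binomially, and log (1 + t)^m / m! generates the S_1(j, m). *)
Require Import Defs.
From HB Require Import structures.
From mathcomp Require Import all_boot all_order all_algebra complex reals ring.

Set Implicit Arguments.
Unset Strict Implicit.
Unset Printing Implicit Defensive.

Import GRing.Theory Num.Theory.
Local Open Scope ring_scope.

(** * Coefficients, derivative and composition of formal power series *)

Section FpsTheory.
Variable A : comNzRingType.
Implicit Types (f g h : fps A) (a b c : A).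

Lemma coef_fpsD f g n : (f + g) n = f n + g n. Proof. by []. Qed.
Lemma coef_fpsN f n : (- f) n = - f n. Proof. by []. Qed.
Lemma coef_fpsM f g n : (f * g) n = \sum_(i < n.+1) f i * g (n - i)%N.
Proof. by []. Qed.
Lemma coef_fps1 n : (1 : fps A) n = (n == 0%N)%:R.
Proof. by rewrite /=; case: (n == 0%N). Qed.

Lemma coef_fpsMn f k n : (f *+ k) n = f n *+ k.
Proof.
elim: k => [|k IHk]; first by rewrite !mulr0n /= if_same.
by rewrite !mulrS coef_fpsD IHk.
Qed.

Lemma coef_fpsCM c f n : (fpsC c * f) n = c * f n.
Proof.
rewrite coef_fpsM big_ord_recl subn0 big1 ?addr0 // => i _.
by rewrite /= mul0r.
Qed.

Lemma fpsCM a b : fpsC (a * b) = fpsC a * fpsC b.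
Proof.
by apply: fpsP => n; rewrite coef_fpsCM /=; case: eqP; rewrite ?mulr0.
Qed.

Definition fpsX : fps A := Fps (fun n => (n == 1%N)%:R).

Lemma coef_fpsXM f n : (fpsX * f) n = if n is n'.+1 then f n' else 0.
Proof.
case: n => [|n]; rewrite coef_fpsM; first by rewrite big_ord1 mul0r.
rewrite 2!big_ord_recl mul0r mul1r add0r big1 ?addr0 ?subSS ?subn0 // => i _.
by rewrite mul0r.
Qed.

Lemma coef_fpsXnM f i n :
  (fpsX ^+ i * f) n = if (i <= n)%N then f (n - i)%N else 0.
Proof.
elim: i n => [|i IHi] n; first by rewrite mul1r subn0.
rewrite exprS -mulrA coef_fpsXM; case: n => [//|n].
by rewrite IHi.
Qed.

Definition fps_deriv f : fps A := Fps (fun n => n.+1%:R * f n.+1).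

(** Only coefficients up to n + 1 matter, so the product rule for polynomials applies to truncations
    at n + 1. *)
Lemma fps_derivM f g : fps_deriv (f * g) = fps_deriv f * g + f * fps_deriv g.
Proof.
apply: fpsP => n; rewrite coef_fpsD /=.
have := @fps_mul_trunc _ n.+1 f g n.+1 (leqnn _); rewrite /= => ->.
rewrite mulr_natl -coef_deriv derivM coefD !coefM.
congr (_ + _); apply: eq_bigr => i _.
  by rewrite coef_deriv !coef_fps_trunc ?ltn_ord ?mulr_natl // leqW // leq_subr.
rewrite coef_deriv !coef_fps_trunc ?mulr_natl // ?ltnS ?leq_subr //.
by rewrite leqW // -ltnS.
Qed.

Lemma fps_derivX f m : fps_deriv (f ^+ m.+1) = fps_deriv f * f ^+ m *+ m.+1.
Proof.
elim: m => [|m IHm]; first by rewrite expr1 mulr1.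
by rewrite exprS fps_derivM IHm mulrnAr mulrCA -exprS [RHS]mulrS.
Qed.

Lemma coef_fpsX_deriv f n : (fpsX * fps_deriv f) n = n%:R * f n.
Proof. by rewrite coef_fpsXM; case: n => [|n]; rewrite ?mul0r. Qed.

(** When t divides h, t^i divides h^i; hence the finite sum in [fps_comp] is the whole composite. *)
Lemma coef_fps_power_lt h i n : h 0%N = 0 -> (n < i)%N -> (h ^+ i) n = 0.
Proof.
move=> h0; elim: i n => [//|i IHi] n ltni.
rewrite exprS coef_fpsM big_ord_recl h0 mul0r add0r big1 // => j _.
case: n ltni j => [_ []//|n ltni] j.
by rewrite IHi ?mulr0 // lift0 subSS (leq_ltn_trans (leq_subr _ _)).
Qed.

Lemma coef_fps_trunc_power N h i n :
  (n <= N)%N -> (fps_trunc N h ^+ i)`_n = (h ^+ i) n.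
Proof.
elim: i n => [|i IHi] n leN; first by rewrite coef1 coef_fps1.
rewrite !exprS coefM coef_fpsM; apply: eq_bigr => j _.
rewrite coef_fps_trunc ?IHi // (leq_trans _ leN) ?leq_subr //.
by rewrite -ltnS.
Qed.

(** Padding both sums to a common length only adds zeros: [p] vanishes beyond its size, and h^i has
    no term of degree n once i > n. *)
Lemma coef_comp_fps_trunc N (p : {poly A}) h n : h 0%N = 0 -> (n <= N)%N ->
  (p \Po fps_trunc N h)`_n = \sum_(i < n.+1) p`_i * (h ^+ i) n.
Proof.
move=> h0 leN; rewrite coef_comp_poly.
under eq_bigr do rewrite coef_fps_trunc_power //.
pose F i := p`_i * (h ^+ i) n; pose M := maxn (size p) n.+1.
transitivity (\sum_(i < M) F i).
  rewrite (@big_ord_widen _ _ _ (size p) M F) ?leq_maxl //= big_mkcond.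
  by apply: eq_bigr => i _; case: ltnP => // le; rewrite /F nth_default ?mul0r.
rewrite (@big_ord_widen _ _ _ n.+1 M F) ?leq_maxr //= [RHS]big_mkcond.
by apply: eq_bigr => i _; case: ltnP => // le; rewrite /F coef_fps_power_lt ?mulr0.
Qed.

Lemma coef_fps_powerN f m n : ((- f) ^+ m) n = (-1) ^+ m * (f ^+ m) n.
Proof.
(* The sign powers live in two rings, [fps A] and [A]; reducing both to the parity of m makes them
   comparable. *)
rewrite [(- f) ^+ m]exprNn -signr_odd -[in RHS]signr_odd.
by case: (odd m); rewrite ?expr1 ?expr0 ?mulN1r ?mul1r.
Qed.

Section Composition.
Variable h : fps A.
Hypothesis h0 : h 0%N = 0.

Lemma fps_comp_trunc f N n : (n <= N)%N ->
  fps_comp f h n = (fps_trunc N f \Po fps_trunc N h)`_n.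
Proof.
move=> leN; rewrite coef_comp_fps_trunc //=; apply: eq_bigr => i _.
by rewrite coef_fps_trunc // (leq_trans _ leN) // -ltnS.
Qed.

(** The product of the truncations agrees with f g up to degree n, which is all that coefficient n
    of the composite sees; polynomial composition is multiplicative. *)
Lemma fps_compM f g : fps_comp (f * g) h = fps_comp f h * fps_comp g h.
Proof.
apply: fpsP => n.
transitivity (((fps_trunc n f * fps_trunc n g) \Po fps_trunc n h)`_n).
  rewrite coef_comp_fps_trunc //=; apply: eq_bigr => i _.
  by rewrite -fps_mul_trunc // -ltnS.
rewrite comp_polyM coefM coef_fpsM; apply: eq_bigr => i _.
by rewrite -!fps_comp_trunc ?leq_subr // -ltnS.
Qed.

Lemma fps_compC c : fps_comp (fpsC c) h = fpsC c.
Proof.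
apply: fpsP => n /=; rewrite big_ord_recl big1 ?addr0 => [|i _].
  by rewrite expr0 coef_fps1 /=; case: (n == 0%N); rewrite ?mulr1 ?mulr0.
by rewrite mul0r.
Qed.

Lemma fps_compX f m : fps_comp (f ^+ m) h = fps_comp f h ^+ m.
Proof.
elim: m => [|m IHm]; first exact: fps_compC.
by rewrite !exprS fps_compM IHm.
Qed.

Lemma fps_compB f g : fps_comp (f - g) h = fps_comp f h - fps_comp g h.
Proof.
apply: fpsP => n; rewrite coef_fpsD coef_fpsN /= -sumrN -big_split.
by apply: eq_bigr => i _; rewrite mulrBl.
Qed.

End Composition.
End FpsTheory.

(** * Coefficientwise action of ring morphisms on series *)

Section MapFps.
Variables (A B : comNzRingType) (u : {rmorphism A -> B}).

Fact map_fps_is_zmod_morphism : zmod_morphism (map_fps u).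
Proof. by move=> f g; apply: fpsP => n /=; rewrite rmorphB. Qed.

Fact map_fps_is_monoid_morphism : monoid_morphism (map_fps u).
Proof.
split=> [|f g]; apply: fpsP => n /=.
  by case: eqP; rewrite ?rmorph1 ?rmorph0.
by rewrite rmorph_sum; apply: eq_bigr => i _; rewrite rmorphM.
Qed.

HB.instance Definition _ := GRing.isZmodMorphism.Build (fps A) (fps B)
  (map_fps u) map_fps_is_zmod_morphism.
HB.instance Definition _ := GRing.isMonoidMorphism.Build (fps A) (fps B)
  (map_fps u) map_fps_is_monoid_morphism.

Lemma map_fpsC c : map_fps u (fpsC c) = fpsC (u c).
Proof. by apply: fpsP => n /=; case: eqP; rewrite ?rmorph0. Qed.

End MapFps.

(** * Stirling numbers of the first kind *)

Lemma stirling1S0 n : stirling1 n.+1 0 = - (n%:Z * stirling1 n 0).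
Proof.
rewrite /stirling1 /falling_poly big_ord_recr /= mulrBr coefB coefMX coefMC /=.
by rewrite sub0r mulrC.
Qed.

(** Coefficient of x^(m+1) in (x)_(n+1) = (x)_n (x - n). *)
Lemma stirling1SS n m :
  stirling1 n.+1 m.+1 = stirling1 n m - n%:Z * stirling1 n m.+1.
Proof.
rewrite /stirling1 /falling_poly big_ord_recr /= mulrBr coefB coefMX coefMC /=.
by rewrite [_ * n%:Z]mulrC.
Qed.

Lemma size_falling_poly n : size (falling_poly n) = n.+1.
Proof.
rewrite /falling_poly size_prod_XsubC.
by rewrite [index_enum _]unlock -enumT size_enum_ord.
Qed.

Lemma stirling1_small n m : (n < m)%N -> stirling1 n m = 0.
Proof.
by move=> ltnm; rewrite /stirling1 nth_default // size_falling_poly.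
Qed.

(** The expansion over the integers is carried to [A] by the canonical morphism and evaluated at
    a. *)
Lemma prodB_stirling1 (A : comNzRingType) (a : A) n :
  \prod_(i < n) (a - i%:R) = \sum_(m < n.+1) (stirling1 n m)%:~R * a ^+ m.
Proof.
transitivity (map_poly intr (falling_poly n)).[a].
  rewrite rmorph_prod horner_prod; apply: eq_bigr => i _.
  by rewrite rmorphB /= map_polyX map_polyC /= hornerD hornerX hornerN hornerC.
rewrite (@horner_coef_wide _ n.+1) => [|].
  by apply: eq_bigr => i _; rewrite coef_map.
by rewrite (leq_trans (size_poly _ _)) // size_falling_poly.
Qed.

(** * Exponential, logarithm and binomial series *)

Section NatUnit.
Variable A : comUnitRingType.
Hypothesis natU : forall n, (n.+1%:R : A) \is a GRing.unit.

Lemma factU n : (n`!%:R : A) \is a GRing.unit.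
Proof. by rewrite -(prednK (fact_gt0 n)) natU. Qed.

Lemma fps_deriv_log1D :
  fps_deriv (fps_log1D A) + fpsX A * fps_deriv (fps_log1D A) = 1.
Proof.
apply: fpsP => n; rewrite coef_fpsD coef_fpsX_deriv coef_fps1 /=.
rewrite mulrCA divrr // mulr1; case: n => [|n]; first by rewrite mul0r addr0.
by rewrite /= mulrCA divrr // mulr1 exprS mulN1r addNr.
Qed.

Lemma coef_log1D_power n m :
  n`!%:R * (fps_log1D A ^+ m) n = m`!%:R * (stirling1 n m)%:~R.
Proof.
have L0 : fps_log1D A 0%N = 0 by [].
elim: n m => [|n IHn] [|m].
- by rewrite expr0 coef_fps1 /stirling1 /falling_poly big_ord0 coef1 mulr1.
- by rewrite coef_fps_power_lt // stirling1_small // !mulr0.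
(* Here n S_1(n, 0) maps to zero in [A]: either n = 0, or the induction hypothesis kills S_1(n,
   0). *)
- rewrite expr0 coef_fps1 mulr0 stirling1S0 mul1r.
  have := IHn 0%N; rewrite expr0 coef_fps1 mul1r rmorphN rmorphM /= => <-.
  by case: n {IHn} => [|n]; rewrite ?mul0r ?mulr0 oppr0.
(* (1 + t) d/dt log(1 + t)^(m+1) = (m + 1) log(1 + t)^m, the generating-function
   form of the recurrence of the Stirling numbers *)
have D : fps_deriv (fps_log1D A ^+ m.+1) n
    + n%:R * (fps_log1D A ^+ m.+1) n = (fps_log1D A ^+ m) n *+ m.+1.
  rewrite -coef_fpsX_deriv -coef_fpsD fps_derivX mulrnAr mulrA -mulrnDl -mulrDl.
  by rewrite fps_deriv_log1D mul1r coef_fpsMn.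
have {D} D : n.+1%:R * (fps_log1D A ^+ m.+1) n.+1
    = m.+1%:R * (fps_log1D A ^+ m) n - n%:R * (fps_log1D A ^+ m.+1) n.
  by rewrite [X in _ = X - _]mulr_natl -D addrK.
rewrite factS mulnC natrM -mulrA D mulrBr mulrCA IHn [X in _ - X]mulrCA IHn.
by rewrite stirling1SS factS natrM rmorphB rmorphM /=; ring.
Qed.

Lemma invr_fact_bin n i : (i <= n)%N ->
  (i`!%:R)^-1 * ((n - i)`!%:R)^-1 = 'C(n, i)%:R / n`!%:R :> A.
Proof.
move=> lein; apply: (mulIr (factU n)); rewrite divrK ?factU //.
rewrite -(bin_fact lein) mulrC -invrM ?factU // natrM -mulrA (mulnC i`!).
by rewrite natrM divrr ?mulr1 // unitrM !factU.
Qed.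

Lemma fps_expD (a b : A) : fps_exp (a + b) = fps_exp a * fps_exp b.
Proof.
apply: fpsP => n; rewrite coef_fpsM /= [a + b]addrC exprDn mulr_suml.
apply: eq_bigr => i _; rewrite mulrACA invr_fact_bin -1?ltnS //.
by rewrite -mulr_natr [b ^+ _ * _]mulrC mulrA.
Qed.

Lemma fps_expMn (a : A) s : fps_exp (a *+ s) = fps_exp a ^+ s.
Proof.
elim: s => [|s IHs]; last by rewrite mulrS exprS fps_expD IHs.
apply: fpsP => -[|n]; first by rewrite /= divr1.
by rewrite /= expr0n mul0r.
Qed.

Lemma coef_log1D_powerE n m :
  (fps_log1D A ^+ m) n = m`!%:R * (stirling1 n m)%:~R / n`!%:R.
Proof. by rewrite -coef_log1D_power mulrC mulKr ?factU. Qed.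

(** The m! carried by log(1 + t)^m cancels the 1/m! of the exponential, leaving the sum of S_1(n, m)
    (-a)^m / n!, which is (-a)_n / n!. *)
Lemma fps_exp_comp_log1D (a : A) :
  fps_comp (fps_exp a) (- fps_log1D A) = fps_pow1D (- a).
Proof.
apply: fpsP => n; rewrite /= /gbinom prodB_stirling1 mulr_suml.
apply: eq_bigr => m _; rewrite coef_fps_powerN coef_log1D_powerE [in RHS]exprNn.
(* Inserting m!/m! on the right matches the left; once the inverses are abstracted, a polynomial
   identity remains. *)
have E (x : A) : x = m`!%:R / m`!%:R * x by rewrite divrr ?factU // mul1r.
rewrite [RHS]E; move: (_^-1) (_^-1) => u v; ring.
Qed.

Lemma fps_pow1DN1_mulr : (1 + fpsX A) * fps_pow1D (-1) = 1.
Proof.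
have E n : fps_pow1D (-1 : A) n = (-1) ^+ n.
  apply: (mulIr (factU n)); rewrite /= /gbinom divrK ?factU //.
  elim: n => [|n IHn]; first by rewrite big_ord0 mulr1.
  by rewrite big_ord_recr /= IHn factS natrM exprS -[n.+1]addn1 natrD; ring.
apply: fpsP => -[|n]; rewrite mulrDl mul1r coef_fpsD coef_fpsXM !E coef_fps1.
  by rewrite addr0.
by rewrite exprS mulN1r addNr.
Qed.

(** Substitution of -log(1 + t) for t in e^(s t) = (e^t)^s. *)
Lemma fps_pow1DN_nat s : fps_pow1D (- s%:R) = fps_pow1D (-1) ^+ s :> fps A.
Proof.
by rewrite -!fps_exp_comp_log1D fps_expMn fps_compX //= oppr0.
Qed.

End NatUnit.

(** * Transport along ring morphisms and rearrangement of sums *)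

Lemma map_fps_pow1D (A B : comUnitRingType) (u : {rmorphism A -> B}) (a : A) :
  (forall n, (n.+1%:R : A) \is a GRing.unit) ->
  map_fps u (fps_pow1D a) = fps_pow1D (u a).
Proof.
move=> natU; apply: fpsP => n; rewrite /= /gbinom rmorph_div ?factU //=.
rewrite rmorph_prod rmorph_nat; congr (_ / _).
by apply: eq_bigr => i _; rewrite rmorphB rmorph_nat.
Qed.

Lemma map_fps_exp (A B : comUnitRingType) (u : {rmorphism A -> B}) (a : A) :
  (forall n, (n.+1%:R : A) \is a GRing.unit) ->
  map_fps u (fps_exp a) = fps_exp (u a).
Proof.
move=> natU; apply: fpsP => n; rewrite /= rmorph_div ?factU //=.
by rewrite rmorphXn rmorph_nat.
Qed.

(** In the binomial expansion, t^i f contributes to degree l only when i <= l, whence the bound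
    min(s, l). *)
Lemma coef_fpsM_1DcXn (A : comNzRingType) (f : fps A) (c : A) s l :
  (f * (1 + fpsC c * fpsX A) ^+ s) l =
  \sum_(i < (minn s l).+1) 'C(s, i)%:R * c ^+ i * f (l - i)%N.
Proof.
rewrite [1 + _]addrC exprD1n mulr_sumr.
have -> (I : finType) (F : I -> fps A) : (\sum_i F i) l = \sum_i F i l.
  elim/big_ind2: _ => [|g x h y <- <-|] //=.
  by rewrite if_same.
pose E i := 'C(s, i)%:R * c ^+ i * f (l - i)%N.
rewrite (@big_ord_widen _ _ _ (minn s l).+1 s.+1 E) ?ltnS ?geq_minl //.
rewrite [RHS]big_mkcond; apply: eq_bigr => i _.
rewrite mulrC exprMn mulrnAl coef_fpsMn -mulrA.
have -> : fpsC c ^+ i = fpsC (c ^+ i).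
  by elim: (i : nat) => [//|j IHj]; rewrite !exprS IHj fpsCM.
rewrite coef_fpsCM coef_fpsXnM ltnS leq_min leq_ord /=.
by case: ifP => _; rewrite ?mulr0 ?mul0rn // /E -mulrA mulr_natl.
Qed.

(** Both sides run over l + m <= n; the triangle is written as a square with a condition so that the
    indices can be exchanged. *)
Lemma exchange_triangle (V : nmodType) (F : nat -> nat -> V) n :
  \sum_(l < n.+1) \sum_(m < (n - l).+1) F l m =
  \sum_(m < n.+1) \sum_(l < (n - m).+1) F l m.
Proof.
have W (G : nat -> V) (k : 'I_n.+1) : \sum_(j < (n - k).+1) G j =
    \sum_(j < n.+1 | (k + j <= n)%N) G j.
  rewrite (@big_ord_widen _ _ _ _ n.+1) ?ltnS ?leq_subr //.
  by apply: eq_bigl => j; rewrite ltnS leq_subRL // -ltnS.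
under eq_bigr do rewrite W; under [RHS]eq_bigr => m _ do rewrite (W (F^~ m)).
rewrite (exchange_big_dep predT) //=; apply: eq_bigr => m _.
by apply: eq_bigl => l; rewrite addnC.
Qed.

Lemma natrU (F : numFieldType) n : (n.+1%:R : F) \is a GRing.unit.
Proof. by rewrite unitfE pnatr_eq0. Qed.

Lemma natr_polyU (F : numFieldType) n : (n.+1%:R : {poly F}) \is a GRing.unit.
Proof.
by rewrite -polyC_natr poly_unitE size_polyC coefC eqxx natrU pnatr_eq0.
Qed.

(** Evaluation at a is a ring morphism, hence acts coefficientwise on series; this computes the
    values CP_j(s). *)
Lemma horner_pow1DNX (F : numFieldType) (f : fps F) (a : F) j :
  ((map_fps polyC f * fps_pow1D (- 'X)) j).[a] = (f * fps_pow1D (- a)) j.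
Proof.
suff E : map_fps (horner_eval a) (map_fps polyC f * fps_pow1D (- 'X)) =
    f * fps_pow1D (- a) by rewrite -E.
rewrite rmorphM /= map_fps_pow1D; last exact: natr_polyU.
rewrite rmorphN /= /horner_eval hornerX; congr (_ * _).
by apply: fpsP => i; rewrite /= hornerC.
Qed.

(** * Substitution in the Frobenius-Euler generating function *)

Section FrobeniusEuler.
Variable F : numFieldType.
Let natU := natrU F.
Let polynatU := natr_polyU F.
Variables (lambda : F) (s : nat).
Hypothesis lambda_neq1 : lambda != 1.

Definition frobenius_euler_fps : fps {poly F} :=
  map_fps polyC ((fpsC (1 - lambda) / (fps_exp 1 - fpsC lambda)) ^+ s)
  * fps_exp 'X.

Lemma frobenius_euler_denomU : fps_exp 1 - fpsC lambda \is a GRing.unit.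
Proof.
by rewrite unfold_in /= /fps_unit /= expr0 divr1 unitfE subr_eq0 eq_sym.
Qed.

(** With [D] inverse to (1 - lambda) / (e^t - lambda), the composite of [D]^s is the explicit
    factor; it cancels the s-th power in the generating function, leaving e^(x t) at -log(1 + t). *)
Lemma pow1D_frobenius_euler :
  fps_pow1D (- 'X) =
  map_fps polyC (fps_pow1D (- s%:R)
    * (1 + fpsC (lambda / (lambda - 1)) * fpsX F) ^+ s)
  * fps_comp frobenius_euler_fps (- fps_log1D {poly F}).
Proof.
have l1 : 1 - lambda != 0 by rewrite subr_eq0 eq_sym.
have L0 : (- fps_log1D {poly F}) 0%N = 0 by rewrite /= oppr0.
pose D := (fps_exp 1 - fpsC lambda) * fpsC ((1 - lambda)^-1).
have DK : D * (fpsC (1 - lambda) / (fps_exp 1 - fpsC lambda)) = 1.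
  have := divrr frobenius_euler_denomU; rewrite /D; move: _^-1 => N' NN'.
  rewrite [RHS](_ : _ = fpsC (1 - lambda)^-1 * fpsC (1 - lambda)); last first.
    by rewrite -fpsCM mulVf.
  by rewrite -[RHS]mul1r -NN'; move: (fps_exp 1 - _) => N; ring.
(* (1 + t)^-1 - lambda = (1 + t)^-1 (1 - lambda - lambda t) *)
have compD : fps_comp (map_fps polyC D) (- fps_log1D {poly F}) =
    map_fps polyC (fps_pow1D (-1) * (1 + fpsC (lambda / (lambda - 1)) * fpsX F)).
  rewrite rmorphM rmorphB /= map_fps_exp // !map_fpsC rmorph1.
  rewrite fps_compM // fps_compB !fps_compC // fps_exp_comp_log1D //.
  rewrite -[X in fps_pow1D X](rmorphN1 polyC) -map_fps_pow1D //
    -!map_fpsC -rmorphB -rmorphM /=.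
  congr (map_fps _ _).
  have -> : lambda / (lambda - 1) = - lambda * (1 - lambda)^-1.
    by rewrite -opprB invrN mulrN mulNr.
  have lC : (1 - fpsC lambda) * fpsC (1 - lambda)^-1 = 1.
    have -> : 1 - fpsC lambda = fpsC (1 - lambda).
      by apply: fpsP => -[|i] //=; rewrite oppr0 addr0.
    by rewrite -fpsCM divff.
  have fpsCN a : fpsC (- a) = - fpsC a :> fps F.
    by apply: fpsP => -[|i] //=; rewrite oppr0.
  (* Units are expanded as (1 - lambda) (1 - lambda)^-1 on the right and (1 + t) (1 + t)^-1 on the
     left, so that both sides agree by ring axioms alone. *)
  rewrite fpsCM fpsCN -lC -[in LHS](mulr1 (fpsC lambda)).
  rewrite -[X in fpsC _ * X](fps_pow1DN1_mulr natU); ring.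
rewrite (fps_pow1DN_nat natU) -exprMn rmorphXn /= -compD -fps_compX //.
rewrite -fps_compM // -rmorphXn /frobenius_euler_fps mulrA -rmorphM -exprMn DK.
rewrite expr1n rmorph1 mul1r.
by rewrite fps_exp_comp_log1D.
Qed.
End FrobeniusEuler.

(** * Comparison of the coefficients of t^n *)

Theorem theorem11 (R : realType) (k : int) (lambda mu : R[i]) (s : nat)
    (lambda_neq1 : lambda != 1) (n : nat) :
  CP k lambda mu n =
  \sum_(m < n.+1)
    ((-1) ^+ m *
     \sum_(l < (n - m).+1) \sum_(i < (minn s l).+1)
       'C(n, l)%:R * 'C(s, i)%:R * (l ^_ i)%:R
       * (lambda / (lambda - 1)) ^+ i
       * (stirling1 (n - l) m)%:~R
       * (CP k lambda mu (l - i)).[s%:R])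
    *: frobenius_euler s lambda m.
Proof.
pose F := peters_factor lambda mu * fps_comp (Lif R k) (fps_log1D R[i]).
pose G := F * fps_pow1D (- s%:R).
have CPs j : (CP k lambda mu j).[s%:R] = j`!%:R * G j.
  rewrite /CP -/F /egf_coef hornerM -polyC_natr hornerC; congr (_ * _).
  exact: horner_pow1DNX.
have -> : CP k lambda mu n =
    n`!%:R * (map_fps polyC (G * (1 + fpsC (lambda / (lambda - 1)) * fpsX _) ^+ s)
     * fps_comp (frobenius_euler_fps lambda s) (- fps_log1D _)) n.
  rewrite /CP -/F /egf_coef (pow1D_frobenius_euler s lambda_neq1).
  by rewrite mulrA -rmorphM mulrA.
rewrite coef_fpsM mulr_sumr.
set Hf := frobenius_euler_fps lambda s; set c := lambda / (lambda - 1).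
pose L := fps_log1D {poly R[i]}.
(* [T l m] pairs degree l of the scalar factor with the m-th term of the composite in degree n - l;
   that term vanishes for m > n - l. *)
pose T l m := n`!%:R * (((G * (1 + fpsC c * fpsX _) ^+ s) l)%:P
  * (Hf m * ((- L) ^+ m) (n - l)%N)).
transitivity (\sum_(l < n.+1) \sum_(m < (n - l).+1) T l m).
  by apply: eq_bigr => l _; rewrite /T -!mulr_sumr.
rewrite exchange_triangle; apply: eq_bigr => m _.
rewrite mulr_sumr scaler_suml; apply: eq_bigr => l _.
have leln : (l <= n)%N.
  by rewrite (leq_trans _ (leq_subr m n)) // -ltnS.
rewrite /T coef_fps_powerN coef_log1D_powerE; last exact: natr_polyU.
rewrite coef_fpsM_1DcXn -/c.
have -> : frobenius_euler s lambda m = m`!%:R * Hf m by [].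
set q := \sum_(i < _) _.
(* The factor l! is split as (l)_i (l - i)!, and (l - i)! turns the coefficient of [G] into
   CP_(l-i)(s). *)
transitivity (((-1) ^+ m * ('C(n, l)%:R * l`!%:R * (stirling1 (n - l) m)%:~R * q))
  *: (m`!%:R * Hf m)); last first.
  congr (_ * _ *: _); rewrite mulr_sumr; apply: eq_bigr => i _.
  have leil : (i <= l)%N.
    by rewrite (leq_trans _ (geq_minr s l)) // -ltnS.
  by rewrite CPs -(ffact_fact leil) natrM; ring.
(* Here n! comes from the normalization of CP_n and 1/(n - l)! from the power of the logarithm. *)
have nE : n`!%:R / (n - l)`!%:R = 'C(n, l)%:R * l`!%:R :> {poly R[i]}.
  rewrite -(bin_fact leln) mulnA !natrM mulrK // factU //.
  exact: natr_polyU.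
rewrite -mul_polyC !rmorphM rmorphXn rmorphN1 !rmorph_nat rmorph_int -nE /=.
ring.
Qed.
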